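(* Let $\mathbf K$ be an infinite field. Every automorphism $\Phi$ of $(Ass\text{-}\mathbf K)^0$ is either semi-inner, or a composition of a semi-inner automorphism and the mirror automorphism $\Upsilon$.
   Context: A $\mathbf K$-algebra is an associative unital ring $A$ with a unital ring homomorphism $f_A:\mathbf K\to Z(A)$; homomorphisms are unital ring homomorphisms commuting with the structure maps. $(Ass\text{-}\mathbf K)^0$ is the category of free associative $\mathbf K$-algebras $\mathbf K\langle X\rangle$ on finite subsets $X$ of a fixed infinite set $X_0$, with all homomorphisms. Twisted homomorphism: for a field automorphism $\varphi$ of $\mathbf K$, a $\varphi$-homomorphism $\sigma:A\to B$ is a unital ring homomorphism with $\sigma(\lambda w)=\varphi(\lambda)\sigma(w)$ for $\lambda\in\mathbf K$, $w\in A$. Semi-inner: an automorphism $\Phi$ is semi-inner if there exist an automorphism $\varphi$ of $\mathbf K$ and, for each object $A$, a bijective $\varphi$-homomorphism $\tau_A:A\to\Phi(A)$, such that $\Phi(\nu)=\tau_B\circ\nu\circ\tau_A^{-1}$ for every morphism $\nu:A\to B$. Inner automorphisms are the case $\varphi=\mathrm{id}$. Mirror automorphism: for a free algebra $A=\mathbf K\langle X_A\rangle$, let $\eta_A$ be the unique $\mathbf K$-linear anti-automorphism of $A$ sending each monomial $x_{i_1}\cdots x_{i_n}$ to $x_{i_n}\cdots x_{i_1}$. The mirror automorphism $\Upsilon$ is defined by $\Upsilon(A)=A$ and $\Upsilon(\nu)=\eta_B\circ\nu\circ\eta_A^{-1}$ for $\nu:A\to B$. *)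

(* Defs.v *)
(* free associative algebras via multinomials' monalg
   ({malg K[{fmonom X}]} = K<X>, the monoid algebra of the free monoid on X). *)
From HB Require Import structures.
From mathcomp Require Import all_boot all_order all_algebra.
From mathcomp Require Import finmap.
From mathcomp Require Import monalg.
Set Implicit Arguments. Unset Strict Implicit. Unset Printing Implicit Defensive.
Import GRing.Theory.
Local Open Scope ring_scope.

Definition infinite_type (T : eqType) : Prop := ~ exists s : seq T, forall x, x \in s.

(* The free associative K-algebra K<X> on a finite subset X of the fixed set X_0 = T. *)
Definition FA (K : fieldType) (T : choiceType) (X : {fset T}) : Type :=
  {malg K[{fmonom X}]}.

Definition AHom (K : fieldType) (T : choiceType) (X Y : {fset T}) : Type :=
  {lrmorphism FA K X -> FA K Y}.

Definition cat_automorphism (K : fieldType) (T : choiceType)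
  (Fo : {fset T} -> {fset T})
  (Fm : forall X Y : {fset T}, AHom K X Y -> AHom K (Fo X) (Fo Y)) : Prop :=
  [/\
      forall X (i : AHom K X X), (forall w, i w = w) -> forall w, Fm X X i w = w,
      forall X Y Z (f : AHom K X Y) (g : AHom K Y Z) (h : AHom K X Z),
        (forall w, h w = g (f w)) -> forall w, Fm X Z h w = Fm Y Z g (Fm X Y f w),
      bijective Fo,
      forall X Y (f g : AHom K X Y), (forall w, Fm X Y f w = Fm X Y g w) ->
        forall w, f w = g w
    &
      forall X Y (g : AHom K (Fo X) (Fo Y)), exists f : AHom K X Y,
        forall w, Fm X Y f w = g w].

Definition phi_hom (K : fieldType) (A B : lalgType K) (phi : K -> K) (s : A -> B) : Prop :=
  [/\ s 1 = 1,
      forall x y, s (x + y) = s x + s y,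
      forall x y, s (x * y) = s x * s y
    & forall (l : K) w, s (l *: w) = phi l *: s w].

Definition eta (K : fieldType) (T : choiceType) (X : {fset T}) (p : FA K X) : FA K X :=
  \sum_(m <- msupp p) << p@_m *g FMonom (rev (fmonom_val m)) >>.

(* The mirror automorphism on morphisms: Upsilon(nu) = eta_B o nu o eta_A^{-1};
   eta_A is an involution, so eta_A^{-1} = eta_A. *)
Definition mirror (K : fieldType) (T : choiceType) (X Y : {fset T})
  (nu : AHom K X Y) : FA K X -> FA K Y :=
  fun w => eta (nu (eta w)).

(* "Phi(nu) = tau_B o G(nu) o tau_A^{-1}" for a field automorphism phi and
   bijective phi-homomorphisms tau_A : A -> Phi(A) (tauinv_A their inverses).
   With G = identity this is "Phi is semi-inner"; with G = mirror it says
   Phi = Psi o Upsilon with Psi semi-inner (Psi(mu) = tau_B o mu o tau_A^{-1}). *)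
Definition semi_inner_after (K : fieldType) (T : choiceType)
  (Fo : {fset T} -> {fset T})
  (Fm : forall X Y : {fset T}, AHom K X Y -> AHom K (Fo X) (Fo Y))
  (G : forall X Y : {fset T}, AHom K X Y -> FA K X -> FA K Y) : Prop :=
  exists phi : {rmorphism K -> K}, bijective phi /\
  exists (tau : forall X : {fset T}, FA K X -> FA K (Fo X))
         (tauinv : forall X : {fset T}, FA K (Fo X) -> FA K X),
    (forall X, [/\ cancel (tau X) (tauinv X), cancel (tauinv X) (tau X)
                 & phi_hom phi (tau X)]) /\
    (forall X Y (nu : AHom K X Y) w,
        Fm X Y nu w = tau Y (G X Y nu (tauinv X w))).

Definition semi_inner (K : fieldType) (T : choiceType)
  (Fo : {fset T} -> {fset T})
  (Fm : forall X Y : {fset T}, AHom K X Y -> AHom K (Fo X) (Fo Y)) : Prop :=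
  semi_inner_after Fm (fun X Y (nu : AHom K X Y) => fun w => nu w).

Definition semi_inner_comp_mirror (K : fieldType) (T : choiceType)
  (Fo : {fset T} -> {fset T})
  (Fm : forall X Y : {fset T}, AHom K X Y -> AHom K (Fo X) (Fo Y)) : Prop :=
  semi_inner_after Fm (@mirror K T).

(* Main.v *)
Require Import Defs.
From HB Require Import structures.
From mathcomp Require Import all_boot all_order all_algebra.
From mathcomp Require Import finmap.
From mathcomp Require Import monalg.
From Stdlib Require Import Classical.

Set Implicit Arguments. Unset Strict Implicit. Unset Printing Implicit Defensive.
Import GRing.Theory.
Local Open Scope ring_scope.

(** Homomorphisms K[x] -> A are the elements of A, so once the rank one algebra is
    recognised inside the category, an automorphism Phi has the form
    Phi(nu) = s nu s^-1 for a natural family of bijections s_A : A -> Phi(A).  The ring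
    operations pulled back along s are natural in A, hence given by noncommutative
    polynomials.  After composing s with an affine map we may assume s 0 = 0 and
    s 1 = 1.  Multiplication by a nonzero scalar becomes an invertible polynomial in one
    variable, i.e. another scalar; as K is infinite, compatibility with scalars then
    forces the pulled back addition to be x + y and the pulled back multiplication to be
    c xy + (1 - c) yx.  Associativity gives c^2 = c, so that s is either multiplicative
    or antimultiplicative. *)

(* Locked, since refuting an equality of words by unfolding {malg _} is very slow. *)
HB.lock Definition word (K : fieldType) (I : choiceType) (s : seq I) :
  {malg K[{fmonom I}]} := << FMonom s >>.

(** * Words as a linear basis of the free algebra *)

Section Words.
Variables (K : fieldType) (I : choiceType).
Local Notation A := {malg K[{fmonom I}]}.

Local Notation word := (@word K I).

Lemma word0 : word [::] = 1.
Proof. by rewrite word.unlock -fmoneE. Qed.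

Lemma word_cat s t : word (s ++ t) = word s * word t.
Proof. by rewrite !word.unlock malgM_def fgmulUU mulr1 [mmul _ _]fmmulE. Qed.

Lemma word_cons i s : word (i :: s) = word [:: i] * word s.
Proof. by rewrite -word_cat. Qed.

Lemma mcoeff_word s m : (word s)@_m = (s == fmonom_val m)%:R.
Proof. by rewrite word.unlock mcoeffU1 fmP. Qed.

Lemma mcoeff_scale_word c s m : (c *: word s)@_m = c * (s == fmonom_val m)%:R.
Proof. by rewrite mcoeffZ (mcoeff_word s m). Qed.

Lemma mcoeff_two_words c d u v m : (c *: word u + d *: word v)@_m =
  c * (u == fmonom_val m)%:R + d * (v == fmonom_val m)%:R.
Proof.
by rewrite mcoeffD; congr (_ + _); apply: mcoeff_scale_word.
Qed.

Lemma malg_wordE (p : A) : p = \sum_(m <- msupp p) p@_m *: word (fmonom_val m).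
Proof.
rewrite {1}[p]monalgE; apply: eq_bigr => m _.
by apply/malgP => k; rewrite mcoeffZ word.unlock !mcoeffU fmK mulr_natr.
Qed.

Lemma malgC_comm (c : K) (p : A) : p * c%:MP = c%:MP * p.
Proof.
rewrite [p]monalgE mulr_suml mulr_sumr; apply: eq_bigr => m _.
by rewrite !malgM_def !fgmulUU mulrC mulm1 mul1m.
Qed.

Lemma malg_scalerAr (c : K) (p q : A) : p * (c *: q) = c *: (p * q).
Proof. by rewrite -!mul_malgC mulrA malgC_comm mulrA. Qed.

Lemma malg_scaleM (c d : K) (p q : A) : (c *: p) * (d *: q) = (c * d) *: (p * q).
Proof. by rewrite -scalerAl (malg_scalerAr d p q) (scalerA c d (p * q)). Qed.

Lemma scale_wordM (c d : K) s t :
  (c *: word s) * (d *: word t) = (c * d) *: word (s ++ t).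
Proof. by rewrite malg_scaleM word_cat. Qed.

End Words.

(** * Substitution of elements for letters *)

Section WordEvaluation.
Variables (I : choiceType) (S : nzRingType) (h : I -> S).

Definition word_eval (m : {fmonom I}) : S := \prod_(i <- fmonom_val m) h i.

Lemma word_eval_mmorphism : mmorphism word_eval.
Proof.
by split=> [m n|]; rewrite /word_eval ?fm1 ?big_nil // fmM big_cat.
Qed.

HB.instance Definition _ :=
  isMultiplicative.Build {fmonom I} S word_eval word_eval_mmorphism.

End WordEvaluation.

Section Evaluation.
Variables (K : fieldType) (I J : choiceType) (h : I -> {malg K[{fmonom J}]}).

Definition eval : {malg K[{fmonom I}]} -> {malg K[{fmonom J}]} :=
  mmap (@malgC _ K) (word_eval h).

HB.instance Definition _ := GRing.Additive.on eval.

Lemma eval_monoid_morphism : monoid_morphism eval.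
Proof.
suff [evalM eval1] : multiplicative eval by split.
by apply: commr_mmap_is_multiplicative => g m m'; rewrite /GRing.comm malgC_comm.
Qed.

HB.instance Definition _ := GRing.isMonoidMorphism.Build
  {malg K[{fmonom I}]} {malg K[{fmonom J}]} eval eval_monoid_morphism.

Lemma eval_scalable : scalable eval.
Proof. by move=> c p; rewrite /eval mmapZ mul_malgC. Qed.

HB.instance Definition _ := GRing.isScalable.Build K
  {malg K[{fmonom I}]} {malg K[{fmonom J}]} *:%R eval eval_scalable.

Lemma evalD p q : eval (p + q) = eval p + eval q.
Proof. exact: raddfD. Qed.

Lemma evalZ c p : eval (c *: p) = c *: eval p.
Proof. exact: linearZ. Qed.

Lemma eval_word s : eval (word K s) = \prod_(i <- s) h i.
Proof. by rewrite word.unlock /eval mmapU mul_malgC scale1r. Qed.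

Lemma evalE p :
  eval p = \sum_(m <- msupp p) p@_m *: \prod_(i <- fmonom_val m) h i.
Proof. by rewrite /eval mmapE; apply: eq_bigr => m _; rewrite mul_malgC. Qed.

Lemma eval_var i : eval (word K [:: i]) = h i.
Proof. by rewrite eval_word big_seq1. Qed.

Lemma eval_two_words c d u v : eval (c *: word K u + d *: word K v) =
  c *: (\prod_(i <- u) h i) + d *: (\prod_(i <- v) h i).
Proof. by rewrite evalD [X in X + _]evalZ [X in _ + X]evalZ !eval_word. Qed.

End Evaluation.

Lemma lrmorph_word (K : fieldType) (I J : choiceType)
    (f : {lrmorphism {malg K[{fmonom I}]} -> {malg K[{fmonom J}]}}) s :
  f (word K s) = \prod_(i <- s) f (word K [:: i]).
Proof.
elim: s => [|i s IHs]; first by rewrite big_nil word0 rmorph1.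
by rewrite big_cons -IHs -rmorphM -word_cons.
Qed.

Lemma eq_lrmorph_malg (K : fieldType) (I J : choiceType)
    (f g : {lrmorphism {malg K[{fmonom I}]} -> {malg K[{fmonom J}]}}) :
  (forall i, f (word K [:: i]) = g (word K [:: i])) -> f =1 g.
Proof.
move=> fg p; rewrite [p]malg_wordE !linear_sum; apply: eq_bigr => m _.
by rewrite !linearZ /= (lrmorph_word f) (lrmorph_word g); congr (_ *: _); apply: eq_bigr.
Qed.

(** Every nonempty word vanishes under this substitution; it isolates constant terms in naturality
    arguments. *)
Lemma eval0 (K : fieldType) (I J : choiceType) (p : {malg K[{fmonom I}]}) :
  eval (fun=> 0 : {malg K[{fmonom J}]}) p = p@_(FMonom [::]) *: 1.
Proof.
rewrite evalE [in RHS](malg_wordE p) raddf_sum scaler_suml; apply: eq_bigr => m _.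
rewrite [X in _ = X *: _]mcoeff_scale_word -scalerA; congr (_ *: _).
case: m => [[|i m]] /=; first by rewrite big_nil scale1r.
by rewrite big_cons mul0r scale0r.
Qed.

(** Words are eigenvectors of a diagonal substitution, so homogeneity becomes an equation on each
    coefficient. *)
Lemma mcoeff_eval_scale (K : fieldType) (I : choiceType) (c : I -> K)
    (p : {malg K[{fmonom I}]}) m :
  (eval (fun i => c i *: word K [:: i]) p)@_m =
  (\prod_(i <- fmonom_val m) c i) * p@_m.
Proof.
have word_scale s : \prod_(i <- s) (c i *: word K [:: i]) =
    (\prod_(i <- s) c i) *: word K s.
  elim: s => [|i s IHs]; first by rewrite !big_nil scale1r word0.
  by rewrite !big_cons IHs; apply: scale_wordM.
rewrite evalE (raddf_sum (mcoeff m)) [in RHS](malg_wordE p) (raddf_sum (mcoeff m)) mulr_sumr.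
apply: eq_bigr => k _; rewrite [RHS]/= word_scale [LHS]mcoeffZ.
rewrite [X in _ * X = _]mcoeff_scale_word [X in _ = _ * X]mcoeff_scale_word.
have [->|_] := eqVneq; first by rewrite !mulr1 mulrC.
by rewrite !mulr0.
Qed.

(** * One letter: comparison with commutative polynomials *)

Section OneVariable.
Variables (K : fieldType) (I : choiceType) (v : I).
Hypothesis all_v : forall i, i = v.
Local Notation A := {malg K[{fmonom I}]}.

Definition to_poly : A -> {poly K} := mmap (@polyC K) (word_eval (fun=> 'X)).

HB.instance Definition _ := GRing.RMorphism.on to_poly.

Lemma to_polyE p : to_poly p = \sum_(m <- msupp p) p@_m *: 'X^(size (fmonom_val m)).
Proof.
rewrite /to_poly mmapE; apply: eq_bigr => m _.
by rewrite mul_polyC /word_eval big_const_seq count_predT iter_mulr_1.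
Qed.

Lemma one_var_word (s : seq I) : s = nseq (size s) v.
Proof. by elim: s => //= i s <-; rewrite (all_v i). Qed.

Lemma coef_to_poly p m : (to_poly p)`_(size (fmonom_val m)) = p@_m.
Proof.
rewrite to_polyE [in RHS](malg_wordE p) raddf_sum coef_sum.
apply: eq_bigr => k _; rewrite coefZ coefXn [RHS]mcoeff_scale_word; congr (_ * _%:R).
congr nat_of_bool; apply/eqP/eqP => [mk|->//].
by rewrite [LHS]one_var_word [RHS]one_var_word mk.
Qed.

Lemma to_poly_eval p q : to_poly (eval (fun=> q) p) = to_poly p \Po to_poly q.
Proof.
rewrite evalE [to_poly p]to_polyE rmorph_sum raddf_sum /=.
apply: eq_bigr => m _; rewrite comp_polyZ comp_Xn_poly.
rewrite big_const_seq count_predT iter_mulr_1 -mul_malgC rmorphM rmorphXn /=.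
by rewrite -mul_polyC; congr (_ * _); rewrite /to_poly mmapC.
Qed.

(** Substitution becomes composition of polynomials, where degrees multiply; a composite equal to
    ['X] forces degree 1. *)
Lemma size_word_eval_var (p q : A) m : eval (fun=> q) p = word K [:: v] ->
  p@_m != 0 -> (size (fmonom_val m) <= 1)%N.
Proof.
move=> pq pm; have := to_poly_eval p q; rewrite pq.
have -> : to_poly (word K [:: v]) = 'X.
  by rewrite word.unlock /to_poly mmapU mul1r /word_eval big_seq1.
move=> /(congr1 (fun r : {poly K} => (size r).-1)).
rewrite size_comp_poly size_polyX /= => /esym/eqP; rewrite muln_eq1 => /andP[/eqP sp _].
rewrite leqNgt; apply: contra pm => m_gt1.
by rewrite -coef_to_poly nth_default // -[size _]prednK ?sp // lt0n;
  apply/eqP => sp0; rewrite sp0 in sp.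
Qed.

End OneVariable.

(** * Infinite types and fields *)

(** Existence of a duplicate-free list of length [n] is doubly negated, because [infinite_type] is
    itself a negation. *)
Lemma infinite_type_uniq (U : eqType) : infinite_type U ->
  forall n, ~ (forall s : seq U, uniq s -> size s != n).
Proof.
move=> infU; elim=> [|n IHn] no_s; first by have := no_s [::] isT.
apply: IHn => s s_uniq; apply/eqP => sn; apply: infU; exists s => x.
apply/negPn/negP => xs; have := no_s (x :: s).
by rewrite /= xs s_uniq sn eqxx => /(_ isT).
Qed.

(** For [n] other than 1, ['X^n - 'X] would be a nonzero polynomial vanishing on all of [K]. *)
Lemma infinite_field_expr (K : fieldType) n : infinite_type K ->
  (forall c : K, c ^+ n = c) -> n = 1%N.
Proof.
move=> infK cn; apply/eqP/negPn/negP => n1.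
have Xn : 'X^n - 'X != 0 :> {poly K}.
  apply/eqP => /polyP/(_ n); rewrite coefB coefXn eqxx coefX (negbTE n1) coef0 subr0.
  by move/eqP; rewrite oner_eq0.
apply: (infinite_type_uniq infK (n := size ('X^n - 'X : {poly K}))) => s s_uniq.
rewrite neq_ltn max_poly_roots //; apply/allP => c _.
by rewrite rootE !hornerE cn subrr.
Qed.

(** * The mirror anti-automorphism *)

Section Mirror.
Variables (K : fieldType) (I : choiceType).
Local Notation A := {malg K[{fmonom I}]}.

(* [Defs.eta] over an arbitrary alphabet, to which it is convertible. *)
Definition mirror_malg (p : A) : A :=
  \sum_(m <- msupp p) << p@_m *g FMonom (rev (fmonom_val m)) >>.

Lemma mirror_malgE p :
  mirror_malg p = \sum_(m <- msupp p) p@_m *: word K (rev (fmonom_val m)).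
Proof.
apply: eq_bigr => m _; apply/malgP => k.
by rewrite mcoeffU [RHS]mcoeff_scale_word mulr_natr fmP.
Qed.

Lemma mirror_malgD p q : mirror_malg (p + q) = mirror_malg p + mirror_malg q.
Proof.
(* Writing the mirror as an [mmap] avoids comparing the supports of [p], [q] and [p + q]. *)
have mirrorE r : mirror_malg r = mmap (@malgC _ K) (fun m => word K (rev (fmonom_val m))) r.
  by rewrite mirror_malgE mmapE; apply: eq_bigr => m _; rewrite mul_malgC.
by rewrite !mirrorE mmapD.
Qed.

Lemma mirror_malgZ c p : mirror_malg (c *: p) = c *: mirror_malg p.
Proof.
rewrite !mirror_malgE scaler_sumr msuppZ; have [->|_] := eqVneq c 0.
  by rewrite big_nil big1 // => m _; rewrite scale0r.
by apply: eq_bigr => m _; rewrite mcoeffZ -scalerA.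
Qed.

Lemma mirror_malg_word s : mirror_malg (word K s) = word K (rev s).
Proof. by rewrite mirror_malgE word.unlock msuppU1 big_seq_fset1 mcoeffUU scale1r. Qed.

Lemma mirror_malg_sum J (r : seq J) (F : J -> A) :
  mirror_malg (\sum_(i <- r) F i) = \sum_(i <- r) mirror_malg (F i).
Proof.
apply: big_morph; first exact: mirror_malgD.
by rewrite mirror_malgE msupp0 big_nil.
Qed.

Lemma mirror_malgM p q : mirror_malg (p * q) = mirror_malg q * mirror_malg p.
Proof.
rewrite {1}(malg_wordE p) mulr_suml mirror_malg_sum [mirror_malg p]mirror_malgE mulr_sumr.
apply: eq_bigr => m _.
rewrite {1}(malg_wordE q) mulr_sumr mirror_malg_sum [mirror_malg q]mirror_malgE mulr_suml.
apply: eq_bigr => n _.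
rewrite [X in mirror_malg X]scale_wordM [RHS]scale_wordM.
by rewrite mirror_malgZ mirror_malg_word rev_cat (mulrC p@_m).
Qed.

Lemma mirror_malgK : involutive mirror_malg.
Proof.
move=> p; rewrite [mirror_malg p]mirror_malgE mirror_malg_sum [RHS]malg_wordE.
by apply: eq_bigr => m _; rewrite mirror_malgZ mirror_malg_word revK.
Qed.

End Mirror.

(** * Combinations of two words and transported products *)

Lemma malg_two_words (K : fieldType) (I : choiceType) (u v : seq I)
    (p : {malg K[{fmonom I}]}) : u != v ->
  (forall m, p@_m != 0 -> fmonom_val m = u \/ fmonom_val m = v) ->
  p = p@_(FMonom u) *: word K u + p@_(FMonom v) *: word K v.
Proof.
move=> uv supp_p; apply/malgP => m; rewrite [RHS]mcoeffD [X in _ = X + _]mcoeff_scale_word.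
rewrite [X in _ = _ + X]mcoeff_scale_word.
have [mu|mu] := eqVneq u; first by rewrite mu fmK -mu eq_sym (negbTE uv) mulr1 mulr0 addr0.
have [mv|mv] := eqVneq v; first by rewrite mv fmK mulr1 mulr0 add0r.
rewrite !mulr0 addr0; apply/eqP/negPn/negP => /supp_p[] E.
  by rewrite E eqxx in mu.
by rewrite E eqxx in mv.
Qed.

Lemma scale1_inj (K : fieldType) (I : choiceType) :
  injective (fun c : K => c *: (1 : {malg K[{fmonom I}]})).
Proof.
move=> c d /(congr1 (mcoeff (FMonom [::]))); rewrite -word0.
rewrite [LHS]mcoeff_scale_word [RHS]mcoeff_scale_word.
by rewrite !mulr1.
Qed.

Lemma transport_mulA (A : Type) (B : nzRingType) (s : A -> B) (t : B -> A) a b c :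
  cancel t s -> t (s a * s (t (s b * s c))) = t (s (t (s a * s b)) * s c).
Proof. by move=> tK; rewrite !tK mulrA. Qed.

(** This expands associativity on [a], [a], [b]; since [c + d = 1], the square [op a a] is just
    [a * a]. *)
Lemma twisted_alternative (K : fieldType) (A : lalgType K) (op : A -> A -> A)
    (c d : K) (a b : A) :
  (forall k (p q : A), p * (k *: q) = k *: (p * q)) ->
  (forall p q, op p q = c *: (p * q) + d *: (q * p)) -> c + d = 1 ->
  op a (op a b) = op (op a a) b ->
  ((c * c) *: (a * (a * b)) + (c * d) *: (a * (b * a))) +
    ((d * c) *: (a * b * a) + (d * d) *: (b * a * a)) =
  c *: (a * a * b) + d *: (b * (a * a)).
Proof.
move=> scaleAr opE cd; rewrite !opE -[in RHS]scalerDl cd scale1r => <-.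
by rewrite mulrDr mulrDl !scaleAr -!scalerAl !scalerDr !scalerA.
Qed.

(** * Morphisms and natural bijections *)

Section AHomTheory.
Variables (K : fieldType) (T : choiceType) (X Y : {fset T}) (nu : AHom K X Y).

Lemma ahomD a b : nu (a + b) = nu a + nu b.
Proof. exact: raddfD. Qed.

Lemma ahomM a b : nu (a * b) = nu a * nu b.
Proof. exact: rmorphM. Qed.

Lemma ahomZ c a : nu (c *: a) = c *: nu a.
Proof. exact: linearZ. Qed.

Lemma ahom1 : nu 1 = 1.
Proof. exact: rmorph1. Qed.

End AHomTheory.

Lemma natural_inverse (K : fieldType) (T : choiceType) (Fo : {fset T} -> {fset T})
    (Fm : forall X Y : {fset T}, AHom K X Y -> AHom K (Fo X) (Fo Y))
    (s : forall X, FA K X -> FA K (Fo X)) (t : forall X, FA K (Fo X) -> FA K X) :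
  (forall X, cancel (@s X) (@t X)) -> (forall X, cancel (@t X) (@s X)) ->
  (forall X Y (nu : AHom K X Y) a, Fm X Y nu (s X a) = s Y (nu a)) ->
  forall X Y (nu : AHom K X Y) w, nu (t X w) = t Y (Fm X Y nu w).
Proof. by move=> sK tK s_nat X Y nu w; apply: (can_inj (sK Y)); rewrite -s_nat !tK. Qed.

(** * Scalars transported along a natural bijection *)

Section NaturalBijection.
Variables (K : fieldType) (T : choiceType) (Fo : {fset T} -> {fset T}).
Variable Fm : forall X Y : {fset T}, AHom K X Y -> AHom K (Fo X) (Fo Y).
Variables (s : forall X, FA K X -> FA K (Fo X)) (t : forall X, FA K (Fo X) -> FA K X).

Hypothesis Fm_full : forall X Y (g : AHom K (Fo X) (Fo Y)),
  exists f : AHom K X Y, forall w, Fm f w = g w.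
Hypothesis sK : forall X, cancel (@s X) (@t X).
Hypothesis tK : forall X, cancel (@t X) (@s X).
Hypothesis s_nat : forall X Y (nu : AHom K X Y) a, Fm nu (s a) = s (nu a).
Hypothesis s0 : forall X, s (0 : FA K X) = 0.

Variables (V : {fset T}) (v : Fo V).
Hypothesis all_v : forall i, i = v.
Let t_nat := natural_inverse sK tK s_nat.

Lemma t0 X : t (0 : FA K (Fo X)) = 0.
Proof. by rewrite -(s0 X) sK. Qed.

(** The operation [w |-> s (mu *: t w)] at the generic element, hence a polynomial in one letter. *)
Definition unary mu : FA K (Fo V) := s (mu *: t (word K [:: v] : FA K (Fo V))).

(** By fullness, substituting [w] for [v] comes from a morphism of the source algebras, to which
    naturality applies. *)
Lemma eval_unary mu X (w : FA K (Fo X)) :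
  eval (fun _ : Fo V => w) (unary mu) = s (mu *: t w).
Proof.
have [f fE] := Fm_full (eval (fun _ : Fo V => w) : AHom K (Fo V) (Fo X)).
by rewrite -[LHS]fE s_nat ahomZ t_nat fE /= eval_var.
Qed.

Definition scalar_map mu : K := (unary mu)@_(FMonom [:: v]).

(** Composition with [unary mu^-1] gives the letter back, which bounds the degree by one; the
    constant term vanishes since [s] and [t] preserve zero. *)
Lemma unaryE mu : mu != 0 -> unary mu = scalar_map mu *: word K [:: v].
Proof.
move=> mu0; have unary_inv : eval (fun=> unary mu^-1) (unary mu) = word K [:: v].
  by rewrite eval_unary {1}/unary sK scalerA divff // scale1r tK.
have const0 : (unary mu)@_(FMonom [::]) = 0.
  apply: (@scale1_inj K (Fo V)); rewrite /= scale0r.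
  by rewrite -(@eval0 K (Fo V) (Fo V)) eval_unary t0 scaler0 s0.
apply/malgP => m; rewrite [RHS]mcoeff_scale_word.
case: m => [[|i [|j m]]] /=.
- by rewrite const0 mulr0.
- by rewrite (all_v i) eqxx mulr1.
rewrite eqseq_cons andbF mulr0; apply/eqP/negPn/negP.
by move/(size_word_eval_var all_v unary_inv).
Qed.

Lemma sZ mu X (a : FA K X) : s (mu *: a) = scalar_map mu *: s a.
Proof.
have [->|mu0] := eqVneq mu 0.
  by rewrite /scalar_map /unary !scale0r !s0 mcoeff0 scale0r.
by rewrite -{1}[a]sK -eval_unary unaryE // evalZ eval_var.
Qed.

End NaturalBijection.

(** * Addition and multiplication transported along a natural bijection *)

Section SemilinearBijection.
Variables (K : fieldType) (T : choiceType) (Fo : {fset T} -> {fset T}).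
Variable Fm : forall X Y : {fset T}, AHom K X Y -> AHom K (Fo X) (Fo Y).
Variables (s : forall X, FA K X -> FA K (Fo X)) (t : forall X, FA K (Fo X) -> FA K X).
Variable phi : K -> K.

Hypothesis infK : infinite_type K.
Hypothesis sK : forall X, cancel (@s X) (@t X).
Hypothesis tK : forall X, cancel (@t X) (@s X).
Hypothesis s_nat : forall X Y (nu : AHom K X Y) a, Fm nu (s a) = s (nu a).
Hypothesis s0 : forall X, s (0 : FA K X) = 0.
Hypothesis s1 : forall X, s (1 : FA K X) = 1.
Hypothesis sZ : forall mu X (a : FA K X), s (mu *: a) = phi mu *: s a.

Variables (W : {fset T}) (x y : W).
Hypothesis xy : x != y.
Hypothesis all_xy : forall i, i = x \/ i = y.

Let t_nat := natural_inverse sK tK s_nat.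

Lemma tZ mu X (w : FA K (Fo X)) : t (phi mu *: w) = mu *: t w.
Proof. by apply: (can_inj (@sK X)); rewrite sZ !tK. Qed.

Lemma s_eval_var (X Y : {fset T}) (h : X -> FA K Y) i :
  Fm (eval h) (s (word K [:: i])) = s (h i).
Proof. by apply: etrans (s_nat _ _) (congr1 _ _); exact: eval_var. Qed.

Definition add_poly : FA K W := t (s (word K [:: x]) + s (word K [:: y])).

Lemma eval_add_poly X (h : W -> FA K X) : eval h add_poly = t (s (h x) + s (h y)).
Proof.
apply: etrans (t_nat (eval h) _) (congr1 _ _).
by rewrite (ahomD (Fm _)) (s_eval_var h x) (s_eval_var h y).
Qed.

(** Homogeneity of degree one leaves only the two single letters; substituting 1 for one and 0 for
    the other determines the coefficients. *)
Lemma add_polyE : add_poly = word K [:: x] + word K [:: y].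
Proof.
have homog mu : eval (fun i => mu *: word K [:: i]) add_poly = mu *: add_poly.
  by rewrite eval_add_poly [X in X + _]sZ [X in _ + X]sZ -scalerDr tZ.
have supp m : add_poly@_m != 0 -> fmonom_val m = [:: x] \/ fmonom_val m = [:: y].
  move=> Pm; have : size (fmonom_val m) = 1%N.
    (* At a word with nonzero coefficient, [homog] says that [mu] to the length of the word equals
       [mu]. *)
    apply: (infinite_field_expr infK) => mu; apply: (mulIf Pm).
    rewrite -[RHS]mcoeffZ -homog mcoeff_eval_scale big_const_seq count_predT.
    by rewrite iter_mulr_1.
  case: (fmonom_val m) => [|i []] //= _.
  by case: (all_xy i) => ->; [left|right].
have xy1 : [:: x] != [:: y] by apply: contra xy => /eqP[->].
have PE := malg_two_words xy1 supp.
have evP X (h : W -> FA K X) : add_poly@_(FMonom [:: x]) *: h x +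
    add_poly@_(FMonom [:: y]) *: h y = t (s (h x) + s (h y)).
  by rewrite -eval_add_poly [in RHS]PE [RHS]eval_two_words !big_seq1.
have c1 : add_poly@_(FMonom [:: x]) = 1.
  have := evP W (fun i => if i == x then 1 else 0).
  rewrite eqxx eq_sym (negbTE xy) scaler0 addr0 s0 addr0 sK => E.
  by apply: (@scale1_inj K W); rewrite /= scale1r.
have c2 : add_poly@_(FMonom [:: y]) = 1.
  have := evP W (fun i => if i == x then 0 else 1).
  rewrite eqxx eq_sym (negbTE xy) scaler0 add0r s0 add0r sK => E.
  by apply: (@scale1_inj K W); rewrite /= scale1r.
by rewrite [LHS]PE c1 c2 2!scale1r.
Qed.

Lemma sD X (a b : FA K X) : s (a + b) = s a + s b.
Proof.
pose h i := if i == x then a else b.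
have := eval_add_poly h; rewrite add_polyE evalD !eval_var /h eqxx.
by rewrite eq_sym (negbTE xy) => ->; rewrite tK.
Qed.

Definition mul_poly : FA K W := t (s (word K [:: x]) * s (word K [:: y])).

Lemma eval_mul_poly X (h : W -> FA K X) : eval h mul_poly = t (s (h x) * s (h y)).
Proof.
apply: etrans (t_nat (eval h) _) (congr1 _ _).
by rewrite (ahomM (Fm _)) (s_eval_var h x) (s_eval_var h y).
Qed.

(** The transported product is homogeneous of degree one in each argument separately, so each letter
    occurs exactly once. *)
Lemma mul_poly_supp m : mul_poly@_m != 0 ->
  fmonom_val m = [:: x; y] \/ fmonom_val m = [:: y; x].
Proof.
move=> Qm; have yx : y != x by rewrite eq_sym.
(* Rescaling the letter [z] alone makes the exponent of [mu] count its occurrences. *)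
have count1 z : (forall mu, eval (fun i => (if i == z then mu else 1) *: word K [:: i])
    mul_poly = mu *: mul_poly) -> count_mem z (fmonom_val m) = 1%N.
  move=> homog; apply: (infinite_field_expr infK) => mu; apply: (mulIf Qm).
  rewrite -[RHS]mcoeffZ -homog mcoeff_eval_scale; congr (_ * _).
  by rewrite -big_mkcond /= big_const_seq iter_mulr_1.
have cx : count_mem x (fmonom_val m) = 1%N.
  apply: count1 => mu; rewrite eval_mul_poly eqxx (negbTE yx) scale1r sZ.
  by rewrite -scalerAl tZ.
have cy : count_mem y (fmonom_val m) = 1%N.
  apply: count1 => mu; rewrite eval_mul_poly eqxx (negbTE xy) scale1r sZ.
  by rewrite malg_scalerAr tZ.
have : size (fmonom_val m) = 2%N.
  have cC : count (predC (pred1 x)) (fmonom_val m) = count_mem y (fmonom_val m).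
    apply: eq_count => i /=.
    by case: (all_xy i) => ->; rewrite eqxx ?(negbTE xy) ?(negbTE yx).
  by rewrite -(count_predC (pred1 x)) cC cx cy.
case: (fmonom_val m) cx cy => [|i [|j []]] //= cx cy _; move: cx cy.
by case: (all_xy i) => ->; case: (all_xy j) => ->;
  rewrite ?eqxx ?(negbTE xy) ?(negbTE yx) //; [left|right].
Qed.

(** Evaluation at the unit gives [c + d = 1], associativity makes [c] idempotent, and an idempotent
    of a field is 0 or 1. *)
Lemma mul_twist : exists c : K, (c = 0 \/ c = 1) /\
  forall X (a b : FA K X), t (s a * s b) = c *: (a * b) + (1 - c) *: (b * a).
Proof.
have yx : y != x by rewrite eq_sym.
have xy2 : [:: x; y] != [:: y; x] by apply: contra xy => /eqP[->].
have QE := malg_two_words xy2 mul_poly_supp.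
set c := mul_poly@_(FMonom [:: x; y]) in QE; set d := mul_poly@_(FMonom [:: y; x]) in QE.
have mulE X (a b : FA K X) : t (s a * s b) = c *: (a * b) + d *: (b * a).
  pose h i := if i == x then a else b.
  have := eval_mul_poly h; rewrite {1}QE [LHS]eval_two_words.
  by rewrite !big_cons !big_nil !mulr1 /h eqxx (negbTE yx) => <-.
have cd : c + d = 1.
  apply: (@scale1_inj K W); rewrite /= scalerDl scale1r.
  by have := mulE W 1 1; rewrite s1 !mulr1 -[X in t X](s1 W) sK.
have dE : 1 - c = d by rewrite -cd addrC addKr.
exists c; split; last by rewrite dE.
(* The word [[:: x; x; y]] has coefficient [c * c] on one side and [c] on the other. *)
have cc : c * c = c.
  have := twisted_alternative (@malg_scalerAr K W) (mulE W) cd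
    (transport_mulA (word K [:: x]) (word K [:: x]) (word K [:: y]) (@tK W)).
  rewrite -!word_cat /= => /(congr1 (mcoeff (FMonom [:: x; x; y]))).
  rewrite [X in X = _]mcoeffD.
  rewrite [X in X + _ = _]mcoeff_two_words [X in _ + X = _]mcoeff_two_words.
  rewrite [X in _ = X]mcoeff_two_words /= !eqseq_cons !eqxx.
  by rewrite (negbTE xy) (negbTE yx) /= !(mulr0, mulr1, addr0).
have /eqP : c * (c - 1) = 0 by rewrite mulrBr mulr1 cc subrr.
by rewrite mulf_eq0 subr_eq0 => /orP[]/eqP->; [left|right].
Qed.

Lemma s_scalar X mu : s (mu *: 1 : FA K X) = phi mu *: 1.
Proof. by rewrite sZ s1. Qed.

Lemma phiD a b : phi (a + b) = phi a + phi b.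
Proof.
apply: (@scale1_inj K (Fo W)); rewrite /= -(s_scalar W) !scalerDl sD.
by rewrite [X in X + _]s_scalar [X in _ + X]s_scalar.
Qed.

Lemma phi_zmod : zmod_morphism phi.
Proof. by move=> a b; apply: (addIr (phi b)); rewrite -phiD !subrK. Qed.

Lemma phi_monoid : monoid_morphism phi.
Proof.
split=> [|a b]; apply: (@scale1_inj K (Fo W)); rewrite /= -(s_scalar W).
  by rewrite !scale1r s1.
by rewrite -[X in s X]scalerA sZ sZ s1 scalerA.
Qed.

(** The inverse takes the constant term of [t (mu *: 1)]; by naturality the zero substitution fixes
    this element, so it is a constant. *)
Lemma phi_bij : bijective phi.
Proof.
exists (fun mu => (t (mu *: 1 : FA K (Fo W)))@_(FMonom [::])) => mu.
  by rewrite -s_scalar sK -word0 mcoeff_scale_word /= mulr1.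
apply: (@scale1_inj K (Fo W)); rewrite /= -(s_scalar W) -(@eval0 K W W).
rewrite (t_nat (eval (fun=> 0 : FA K W)) (mu *: 1)) tK ahomZ.
by rewrite ahom1.
Qed.

Lemma semi_inner_dichotomy : semi_inner Fm \/ semi_inner_comp_mirror Fm.
Proof.
pose phiA := GRing.isZmodMorphism.Build K K phi phi_zmod.
pose phiM := GRing.isMonoidMorphism.Build K K phi phi_monoid.
pose phi' : {rmorphism K -> K} := HB.pack phi phiA phiM.
have FmE X Y (nu : AHom K X Y) w : Fm nu w = s (nu (t w)) by rewrite t_nat tK.
have [c [[c0|c1] mulE]] := mul_twist; [right|left].
  have sM X (a b : FA K X) : s (a * b) = s b * s a.
    by rewrite -[RHS]tK mulE c0 scale0r add0r subr0 scale1r.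
  exists phi'; split; first exact: phi_bij.
  exists (fun X a => s (Defs.eta a)), (fun X w => Defs.eta (t w)); split=> [X|X Y nu w].
    split=> [a|w|]; first by rewrite sK [LHS]mirror_malgK.
      by rewrite [Defs.eta _]mirror_malgK tK.
    split=> [|a b|a b|mu a].
    - by rewrite -(word0 K X) [Defs.eta _]mirror_malg_word word0 s1.
    - by rewrite [Defs.eta _]mirror_malgD sD.
    - by rewrite [Defs.eta _]mirror_malgM sM.
    by rewrite [Defs.eta _]mirror_malgZ sZ.
  rewrite /mirror [Defs.eta (Defs.eta (t w))]mirror_malgK FmE.
  by congr s; rewrite [RHS]mirror_malgK.
have sM X (a b : FA K X) : s (a * b) = s a * s b.
  by rewrite -[RHS]tK mulE c1 subrr scale0r addr0 scale1r.
exists phi'; split; first exact: phi_bij.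
exists s, t; split=> [X|X Y nu w]; last exact: FmE.
split=> //; split=> [|a b|a b|mu a]; [exact: s1|exact: sD|exact: sM|exact: sZ].
Qed.

End SemilinearBijection.

(** * Recognising the algebra of rank one *)

Lemma one_var_mulC (K : fieldType) (I : choiceType) (v : I) : (forall i, i = v) ->
  commutative (@GRing.mul {malg K[{fmonom I}]}).
Proof.
move=> all_v p q; apply/malgP => m.
have to_polyM (a b : {malg K[{fmonom I}]}) : to_poly (a * b) = to_poly a * to_poly b.
  exact: rmorphM.
have pq := etrans (to_polyM p q) (etrans (mulrC _ _) (esym (to_polyM q p))).
rewrite -[LHS](coef_to_poly all_v).
apply: etrans (coef_to_poly all_v _ m).
exact: (congr1 (fun r : {poly K} => r`_(size (fmonom_val m))) pq).
Qed.

Lemma word_inj (K : fieldType) (I : choiceType) : injective (@word K I).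
Proof.
move=> u v /(congr1 (mcoeff (FMonom v))); rewrite !mcoeff_word eqxx => /eqP.
by have [//|_] := eqVneq u; rewrite eq_sym oner_eq0.
Qed.

Section Automorphism.
Variables (K : fieldType) (T : choiceType) (Fo : {fset T} -> {fset T}).
Variable Fm : forall X Y : {fset T}, AHom K X Y -> AHom K (Fo X) (Fo Y).
Hypothesis Fm_cat : cat_automorphism Fm.

Lemma Fm_id X (f : AHom K X X) : (forall w, f w = w) -> forall w, Fm f w = w.
Proof. by case: Fm_cat => + _ _ _ _; apply. Qed.

Lemma Fm_comp X Y Z (f : AHom K X Y) (g : AHom K Y Z) (h : AHom K X Z) :
  (forall w, h w = g (f w)) -> forall w, Fm h w = Fm g (Fm f w).
Proof. by case: Fm_cat => _ + _ _ _; apply. Qed.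

Lemma Fm_faithful X Y (f g : AHom K X Y) : (forall w, Fm f w = Fm g w) ->
  forall w, f w = g w.
Proof. by case: Fm_cat => _ _ _ + _; apply. Qed.

Lemma Fm_full X Y (g : AHom K (Fo X) (Fo Y)) :
  exists f : AHom K X Y, forall w, Fm f w = g w.
Proof. by case: Fm_cat => _ _ _ _; apply. Qed.

(** [Fm] acts on bundled morphisms, so respect for pointwise equality is extracted from the
    composition law, with an identity as second factor. *)
Lemma Fm_ext X Y (f g : AHom K X Y) : (forall w, f w = g w) ->
  forall w, Fm f w = Fm g w.
Proof.
move=> fg w; have gf u : g u = (idfun : AHom K Y Y) (f u) by rewrite fg.
by apply: esym; apply: etrans (Fm_comp gf w) (Fm_id _ _).
Qed.

Lemma ahom_ext (X Y : {fset T}) (f g : AHom K X Y) :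
  (forall i, f (word K [:: i]) = g (word K [:: i])) -> forall w, f w = g w.
Proof. exact: eq_lrmorph_malg. Qed.

Lemma fset0_elt (X : {fset T}) (i : X) : X = fset0%fset -> False.
Proof. by move=> X0; have := fsvalP i; rewrite [X in _ \in X]X0 inE. Qed.

(** If [Fo X] were empty, all morphisms out of its algebra would agree, and faithfulness would
    equate the identity of [FA K X] with the zero substitution. *)
Lemma Fo_inhabited (X : {fset T}) : inhabited X -> inhabited (Fo X).
Proof.
case=> x; case: (fset_0Vmem (Fo X)) => [Fo0|[z zX]]; last by exists; exists z.
pose z := eval (fun _ : X => 0 : FA K X) : AHom K X X.
have /Fm_faithful/(_ (word K [:: x])) : forall w, Fm (idfun : AHom K X X) w = Fm z w.
  by apply: ahom_ext => i; have := fset0_elt i Fo0.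
rewrite /= eval_var => /(congr1 (mcoeff (FMonom [:: x]))) /eqP.
by rewrite mcoeff_word eqxx mcoeff0 oner_eq0.
Qed.

(** The same argument in reverse: fullness lifts the identity and the zero substitution from
    [Fo X]. *)
Lemma Fo_inhabited_inv (X : {fset T}) : inhabited (Fo X) -> inhabited X.
Proof.
case=> x; case: (fset_0Vmem X) => [X0|[z zX]]; last by exists; exists z.
pose z := eval (fun _ : Fo X => 0 : FA K (Fo X)) : AHom K (Fo X) (Fo X).
have [f fE] := Fm_full (idfun : AHom K (Fo X) (Fo X)); have [g gE] := Fm_full z.
have : forall w, f w = g w by apply: ahom_ext => i; have := fset0_elt i X0.
move=> /Fm_ext/(_ (word K [:: x])); rewrite fE gE /= eval_var.
move=> /(congr1 (mcoeff (FMonom [:: x]))) /eqP.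
by rewrite mcoeff_word eqxx mcoeff0 oner_eq0.
Qed.

(* K[x] is a retract of every algebra of positive rank, whereas a retract of K[x] is
   commutative. *)
Lemma Fo_rank1 (V : {fset T}) (x : V) : (forall i, i = x) ->
  exists v : Fo V, forall i, i = v.
Proof.
move=> all_x; have [v] := Fo_inhabited (inhabits x); exists v => i.
have [G _ GK] : bijective Fo by case: Fm_cat.
(* [W] is the object whose image has a single letter; it has positive rank, so [V] is a retract of
   it. *)
pose W := G [fset val v]%fset; have FoW : Fo W = [fset val v]%fset by apply: GK.
have vW : val v \in Fo W by rewrite FoW fset11.
have [w] := @Fo_inhabited_inv W (inhabits (FSetSub vW)).
pose f := eval (fun _ : V => word K [:: w]) : AHom K V W.
pose g := eval (fun _ : W => word K [:: x]) : AHom K W V.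
have gfK a : Fm g (Fm f a) = a.
  have gf : forall a, (idfun : AHom K V V) a = g (f a).
    apply: (@ahom_ext V V idfun (g \o f)) => j.
    by rewrite /= !eval_var (all_x j).
  by rewrite -(Fm_comp gf) Fm_id.
have FoW_comm : commutative (@GRing.mul {malg K[{fmonom (Fo W)}]}).
  apply: (@one_var_mulC K _ (FSetSub vW)) => j; apply: val_inj => /=.
  by have := fsvalP j; rewrite [X in _ \in X]FoW inE => /eqP.
have FoV_comm : commutative (@GRing.mul {malg K[{fmonom (Fo V)}]}).
  move=> a b; apply: (can_inj gfK).
  exact: etrans (ahomM _ _ _) (etrans (FoW_comm _ _) (esym (ahomM _ _ _))).
(* Commuting letters coincide, by comparing the words [[:: i; v]] and [[:: v; i]]. *)
have iv := etrans (word_cat K [:: i] [:: v])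
  (etrans (FoV_comm _ _) (esym (word_cat K [:: v] [:: i]))).
by have [] := word_inj iv.
Qed.

(** * Elements as morphisms out of the rank one algebra *)

Section Representation.
Variables (V : {fset T}) (x : V) (v : Fo V).
Hypothesis all_x : forall i, i = x.
Hypothesis all_v : forall i, i = v.

Definition elt_hom X (a : FA K X) : AHom K V X := eval (fun=> a).

Lemma elt_hom_var X (a : FA K X) : elt_hom a (word K [:: x]) = a.
Proof. exact: eval_var. Qed.

Lemma elt_homP X (f : AHom K V X) w : elt_hom (f (word K [:: x])) w = f w.
Proof. by apply: ahom_ext => i; rewrite (all_x i) elt_hom_var. Qed.

(** The composite of bijections from A to Hom(K[x], A), to Hom(Phi(K[x]), Phi(A)), to Phi(A), the
    last being evaluation at [v]. *)
Definition elt_map X (a : FA K X) : FA K (Fo X) := Fm (elt_hom a) (word K [:: v]).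

Lemma elt_map_nat X Y (nu : AHom K X Y) a : Fm nu (elt_map a) = elt_map (nu a).
Proof.
rewrite /elt_map -(@Fm_comp _ _ _ _ _ (elt_hom (nu a))) // => w.
by rewrite -{1}(elt_hom_var a) (elt_homP (nu \o elt_hom a)).
Qed.

Lemma elt_map_inj X : injective (@elt_map X).
Proof.
move=> a b ab; rewrite -(elt_hom_var a) -(elt_hom_var b).
by apply: Fm_faithful; apply: ahom_ext => i; rewrite (all_v i).
Qed.

(** Fullness lifts the substitution of [w] for [v]. The boolean [==] lets [xchoose] extract a
    preimage. *)
Lemma elt_map_surj X (w : FA K (Fo X)) : exists a, elt_map a == w.
Proof.
have [f fE] := Fm_full (eval (fun _ : Fo V => w) : AHom K (Fo V) (Fo X)).
exists (f (word K [:: x])); rewrite /elt_map (Fm_ext (elt_homP f)) fE /=.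
by rewrite eval_var.
Qed.

Definition elt_map_inv X (w : FA K (Fo X)) : FA K X := xchoose (elt_map_surj w).

Lemma elt_map_invK X : cancel (@elt_map_inv X) (@elt_map X).
Proof. by move=> w; apply/eqP/(xchooseP (elt_map_surj w)). Qed.

Lemma elt_mapK X : cancel (@elt_map X) (@elt_map_inv X).
Proof. by move=> a; apply: elt_map_inj; rewrite elt_map_invK. Qed.

(** The zero substitution reduces an element to its constant term, so the preimage of [k *: 1] in
    rank one gives one [c] valid for every [X]. *)
Lemma elt_map_scalar (k : K) : exists c : K, forall X, elt_map (c *: 1 : FA K X) = k *: 1.
Proof.
pose a := elt_map_inv (k *: 1 : FA K (Fo V)); exists (a@_(FMonom [::])) => X.
have := elt_map_nat (elt_hom (0 : FA K X)) a.
by rewrite elt_map_invK ahomZ ahom1 /= [X in elt_map X]eval0.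
Qed.

(** The affine map sending 0 and 1 to the preimages [c] and [e] of 0 and 1 commutes with all
    morphisms, so naturality survives the correction. *)
Lemma normalized_elt_map : exists (s : forall X, FA K X -> FA K (Fo X))
    (t : forall X, FA K (Fo X) -> FA K X),
  [/\ forall X, cancel (s X) (t X), forall X, cancel (t X) (s X),
      forall X Y (nu : AHom K X Y) a, Fm nu (s X a) = s Y (nu a),
      forall X, s X 0 = 0 & forall X, s X 1 = 1].
Proof.
have [c cE] := elt_map_scalar 0; have [e eE] := elt_map_scalar 1.
have ec : e - c != 0.
  rewrite subr_eq0; apply/eqP => ec; have := eE V; rewrite ec cE.
  by move/scale1_inj/eqP; rewrite eq_sym oner_eq0.
exists (fun X a => elt_map ((e - c) *: a + c *: 1)).
exists (fun X w => (e - c)^-1 *: (elt_map_inv w - c *: 1)).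
split=> [X a|X w|X Y nu a|X|X].
- by rewrite elt_mapK addrK scalerA mulVf // scale1r.
- by rewrite scalerA mulfV // scale1r subrK elt_map_invK.
- by rewrite elt_map_nat ahomD [X in X + _]ahomZ [X in _ + X]ahomZ ahom1.
- by rewrite scaler0 add0r cE scale0r.
by rewrite -scalerDl subrK eE scale1r.
Qed.

End Representation.
End Automorphism.

Theorem mainTheorem10 (K : fieldType) (hK : infinite_type K)
  (T : choiceType) (hT : infinite_type T)
  (Fo : {fset T} -> {fset T})
  (Fm : forall X Y : {fset T}, AHom K X Y -> AHom K (Fo X) (Fo Y))
  (hPhi : cat_automorphism Fm) :
  semi_inner Fm \/ semi_inner_comp_mirror Fm.
Proof.
have [x0 [y0 xy0]] : exists x0 y0 : T, x0 != y0.
  apply: NNPP => noxy; apply: (infinite_type_uniq hT (n := 2)) => [[|x [|y []]]] //.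
  by rewrite /= inE andbT => xy; case: noxy; exists x, y.
(* [V], of rank one, represents elements; [W], of rank two, carries the generic pair for binary
   operations. *)
pose V := [fset x0]%fset; pose W := [fset x0; y0]%fset.
have x0V : x0 \in V by rewrite fset11.
have x0W : x0 \in W by rewrite !inE eqxx.
have y0W : y0 \in W by rewrite !inE eqxx orbT.
have all_x (i : V) : i = FSetSub x0V.
  by apply: val_inj; apply/eqP; have := valP i; rewrite inE.
have all_xy (i : W) : i = FSetSub x0W \/ i = FSetSub y0W.
  by have := valP i; rewrite !inE => /orP[]/eqP E; [left|right]; apply: val_inj.
have [v all_v] := Fo_rank1 hPhi all_x.
have [s [t [sK tK s_nat s0 s1]]] := normalized_elt_map hPhi all_x all_v.
have sZ := sZ (Fm_full hPhi) sK tK s_nat s0 all_v.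
exact: (semi_inner_dichotomy hK sK tK s_nat s0 s1 sZ (x := FSetSub x0W) (y := FSetSub y0W)).
Qed.
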